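(* For a positive integer $m$, let $n=m$, $\mathbf A=\mathbf 0\in\mathbb R^{m\times m}$, $\mathbf c=\mathbf 0$, $\mathbf d=\mathbf e$, and $$\mathcal U=\operatorname{conv}\left(\mathbf 0,\mathbf e_1,\dots,\mathbf e_m,\boldsymbol\nu_1,\dots,\boldsymbol\nu_m\right),\qquad \boldsymbol\nu_i=\tfrac{1}{\sqrt m}(\mathbf e-\mathbf e_i),\ i\in[m].$$ Let $\tilde{\mathbf B}\in\mathbb R_+^{m\times m}$ be the random matrix with $\tilde B_{ii}=1$ and $\tilde B_{ij}=\frac{1}{\sqrt m}\tilde u_{ij}$ for $i\neq j$, where the $\tilde u_{ij}$ ($i\ne j$) are i.i.d. uniform on $[0,1]$. Then with probability at least $1-\frac1m$, $$z_{\sf Aff}(\tilde{\mathbf B})=\Omega(\sqrt m)\cdot z_{\sf AR}(\tilde{\mathbf B}),$$ i.e. there are absolute constants $C>0$ and $m_0$ such that for all $m\ge m_0$, with probability at least $1-\frac1m$, $z_{\sf Aff}(\tilde{\mathbf B})\ge C\sqrt m\, z_{\sf AR}(\tilde{\mathbf B})$.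
   Context: For data $\mathbf A,\mathbf B\in\mathbb R_+^{m\times n}$, $\mathbf c,\mathbf d\in\mathbb R_+^n$ and a compact convex set $\mathcal U\subseteq\mathbb R^m_+$, the two-stage adjustable robust problem is $$z_{\sf AR}(\mathbf B)=\min_{\mathbf x\in\mathbb R^n_+}\ \mathbf c^T\mathbf x+\max_{\mathbf h\in\mathcal U}\ \min_{\mathbf y(\mathbf h)\in\mathbb R^n_+:\ \mathbf A\mathbf x+\mathbf B\mathbf y(\mathbf h)\ge \mathbf h}\ \mathbf d^T\mathbf y(\mathbf h).$$ The affine policy problem $z_{\sf Aff}(\mathbf B)$ is the same problem with the second-stage decision restricted to $\mathbf y(\mathbf h)=\mathbf P\mathbf h+\mathbf q$ for some $\mathbf P\in\mathbb R^{n\times m}$, $\mathbf q\in\mathbb R^n$: it is the minimum over $\mathbf x\in\mathbb R^n_+,\mathbf P,\mathbf q$ of $\mathbf c^T\mathbf x+\max_{\mathbf h\in\mathcal U}\mathbf d^T(\mathbf P\mathbf h+\mathbf q)$ subject to $\mathbf A\mathbf x+\mathbf B(\mathbf P\mathbf h+\mathbf q)\ge\mathbf h$ and $\mathbf P\mathbf h+\mathbf q\ge\mathbf 0$ for all $\mathbf h\in\mathcal U$. $\mathbf e$ is the all-ones vector and $\mathbf e_i$ the $i$-th standard basis vector of $\mathbb R^m$. *)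

(* Defs.v *)
From HB Require Import structures.
From mathcomp Require Import all_boot all_order all_algebra.
From mathcomp Require Import all_classical all_reals all_analysis.
Set Implicit Arguments. Unset Strict Implicit. Unset Printing Implicit Defensive.
Import Order.TTheory GRing.Theory Num.Theory.
Local Open Scope classical_set_scope.
Local Open Scope ring_scope.

Section Defs.
Variable R : realType.

Definition cvle (k : nat) (u v : 'cV[R]_k) : Prop := forall i, u i 0 <= v i 0.
Definition cvnonneg (k : nat) (u : 'cV[R]_k) : Prop := cvle 0 u.

Definition dotcv (k : nat) (a b : 'cV[R]_k) : R := (a^T *m b) 0 0.

(* second-stage value  min { d^T y : y >= 0, A x + B y >= h } (inf, +oo if infeasible) *)
Definition second_stage (m n : nat) (A B : 'M[R]_(m, n)) (d : 'cV[R]_n)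
    (x : 'cV[R]_n) (h : 'cV[R]_m) : \bar R :=
  ereal_inf [set (dotcv d y)%:E | y in
     [set y : 'cV[R]_n | cvnonneg y /\ cvle h (A *m x + B *m y)]].

Definition z_AR (m n : nat) (A B : 'M[R]_(m, n)) (c d : 'cV[R]_n)
    (U : set 'cV[R]_m) : \bar R :=
  ereal_inf [set ((dotcv c x)%:E + ereal_sup [set second_stage A B d x h | h in U])%E
             | x in [set x : 'cV[R]_n | cvnonneg x]].

Definition z_Aff (m n : nat) (A B : 'M[R]_(m, n)) (c d : 'cV[R]_n)
    (U : set 'cV[R]_m) : \bar R :=
  ereal_inf [set ((dotcv c xPq.1.1)%:E
                  + ereal_sup [set (dotcv d (xPq.1.2 *m h + xPq.2))%:E | h in U])%E
             | xPq in [set xPq : 'cV[R]_n * 'M[R]_(n, m) * 'cV[R]_n |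
                 cvnonneg xPq.1.1 /\
                 forall h, U h ->
                   cvle h (A *m xPq.1.1 + B *m (xPq.1.2 *m h + xPq.2)) /\
                   cvnonneg (xPq.1.2 *m h + xPq.2)]].

Definition conv_pts (k : nat) (pts : seq 'cV[R]_k) : set 'cV[R]_k :=
  [set h | exists w : 'I_(size pts) -> R,
      (forall j, 0 <= w j) /\ \sum_j w j = 1 /\ h = \sum_j w j *: pts`_j].

Definition ebase (m : nat) (i : 'I_m) : 'cV[R]_m := delta_mx i 0.
Definition eone (m : nat) : 'cV[R]_m := const_mx 1.
Definition nu (m : nat) (i : 'I_m) : 'cV[R]_m :=
  (Num.sqrt (m%:R : R))^-1 *: (eone m - ebase i).

Definition U_ex (m : nat) : set 'cV[R]_m :=
  conv_pts (0 :: [seq ebase i | i <- enum 'I_m] ++ [seq nu i | i <- enum 'I_m]).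

Definition Btilde (m : nat) (u : nat -> R) : 'M[R]_(m, m) :=
  \matrix_(i, j) (if i == j then 1
                  else (Num.sqrt (m%:R : R))^-1 * u (i * m + j)%N).

Definition unit_itv : set R := `[(0:R), (1:R)]%classic.

(* iterated Lebesgue integral over the cube [0,1]^k of F, coordinates 0..k-1
   (the remaining coordinates are set to 0) *)
Fixpoint cube_int (k : nat) (F : (nat -> R) -> \bar R) : \bar R :=
  match k with
  | 0 => F (fun _ => (0:R))
  | k'.+1 => (\int[lebesgue_measure]_(t in unit_itv)
               cube_int k' (fun u => F (fun i => if i == k' then t else u i)))%E
  end.

(* probability of an event E under k i.i.d. Uniform[0,1] coordinates *)
Definition cube_prob (k : nat) (E : set (nat -> R)) : \bar R :=
  cube_int k (fun u => (\1_E u)%:E).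

End Defs.

(* Main.v *)
(**
The lower bound on the affine value holds for every matrix with unit diagonal
and off-diagonal entries at most 1/sqrt m.  If all costs are below sqrt m / 8,
covering e_i forces P_ii + q_i >= 7/8.  Non-negativity of the j-th coordinate at
nu_j keeps the off-diagonal part of row j of P above - sqrt m * q_j, so the sum
of all entries of P is of order m; averaging the costs at nu_1, ..., nu_m then
gives a cost of order sqrt m, a contradiction.

The adjustable value is at most 8 as soon as the uniform variables of each row
of the matrix sum to at least m/8: answer e_i by e_i and nu_i by (8/m) e, then
extend to the convex hull.  Since exp (- t) <= 1 - t/2 on [0, 1], the indicator
of this event is at least 1 - sum_i exp (m/8) prod_j (1 - u_ij / 2) on the cube,
and the integral of that function is 1 - m exp (m/8) (3/4)^m.  Working with this
minorant avoids any measurability question about the event of the theorem.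
*)
Require Import Defs.
From HB Require Import structures.
From mathcomp Require Import all_boot all_order all_algebra.
From mathcomp Require Import all_classical all_reals all_analysis.
From mathcomp Require Import ring lra.
Import Order.TTheory GRing.Theory Num.Theory.
Import numFieldNormedType.Exports.
Local Open Scope classical_set_scope.
Local Open Scope ring_scope.

(** * Integration over the cube *)

(* [integral] is a difference of suprema over simple functions, hence monotone
   even on non-measurable functions. *)
Lemma integral_mono (d : measure_display) (T : measurableType d) (R : realType)
    (mu : {measure set T -> \bar R}) (D : set T) (f g : T -> \bar R) :
  (forall x, D x -> (f x <= g x)%E) ->
  (\int[mu]_(x in D) f x <= \int[mu]_(x in D) g x)%E.
Proof.
move=> fg; have fgD x : ((f \_ D) x <= (g \_ D) x)%E by exact: lee_restrict.
rewrite /integral; apply: leeB; apply: le_ereal_sup => _ [h hle <-];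
  exists h => // x; apply: le_trans (hle x) _.
  by apply: (@funepos_le _ _ setT) => [y _|]; [exact: fgD|exact: in_setT].
by apply: (@funeneg_le _ _ setT) => [y _|]; [exact: fgD|exact: in_setT].
Qed.

Lemma integral_affine (R : realType) (a b : R) :
  (\int[lebesgue_measure]_(t in @unit_itv R) (a + b * t)%:E)%E = (a + b / 2)%:E.
Proof.
pose F t : R := a * t + b / 2 * t ^+ 2.
have dF (t : R) : is_derive t 1 F (a + b * t).
  rewrite /F; apply: is_derive_eq.
  by rewrite /GRing.scale /=; field.
rewrite /unit_itv (@continuous_FTC2 _ _ F) //.
- by rewrite -EFinB /F; congr EFin; field.
- apply: continuous_subspaceT => t.
  apply: continuousD; first exact: cst_continuous.
  by apply: continuousM; [exact: cst_continuous|].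
- have cF t : {for t, continuous F}.
    by apply/differentiable_continuous/derivable1_diffP; apply: ex_derive.
  split.
  + by move=> t _; apply: ex_derive.
  + by apply: cvg_at_right_filter; apply: cF.
  + by apply: cvg_at_left_filter; apply: cF.
- by move=> t _; rewrite derive1E derive_val.
Qed.

Lemma cube_int_mono (R : realType) (k : nat) (F G : (nat -> R) -> \bar R) :
  (forall u, (forall i, (i < k)%N -> 0 <= u i <= 1) -> (F u <= G u)%E) ->
  (cube_int k F <= cube_int k G)%E.
Proof.
elim: k F G => [|k IH] F G FG /=; first exact: FG.
apply: integral_mono => t; rewrite /unit_itv /= in_itv /= => t01.
apply: IH => u u01; apply: FG => i; rewrite ltnS leq_eqVlt.
by case: eqVneq => //= _; apply: u01.
Qed.

(** This class of integrands is stable under integrating out the last coordinate: for fixed [t] its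
    factor is a scalar absorbed into [c], hence the induction over all [c]. What remains is affine
    in [t] and integrates to its value at 1/2. *)
Lemma cube_int_sum_prod_affine (R : realType) (I : finType) (k : nat) (c0 : R)
    (c : I -> R) (a b : I -> nat -> R) :
  cube_int k (fun u =>
      (c0 + \sum_i c i * \prod_(0 <= l < k) (a i l + b i l * u l))%:E) =
  (c0 + \sum_i c i * \prod_(0 <= l < k) (a i l + b i l / 2))%:E.
Proof.
elim: k c => [|k IH] c /=.
  by congr (_ + _)%:E; apply: eq_bigr => i _; rewrite !big_geq.
under eq_integral => t _.
  rewrite [X in cube_int _ X](_ : _ = fun u => (c0 + \sum_i
    c i * (a i k + b i k * t) * \prod_(0 <= l < k) (a i l + b i l * u l))%:E).
    rewrite IH.
    over.
  apply/funext => u; congr (_ + _)%:E; apply: eq_bigr => i _.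
  rewrite big_nat_recr //= eqxx [in RHS]mulrAC -mulrA; congr (_ * (_ * _)).
  by apply: eq_big_nat => l /andP[_ lk]; rewrite ltn_eqF.
pose P i := \prod_(0 <= l < k) (a i l + b i l / 2).
under eq_integral => t _.
  rewrite [X in X%:E](_ : _ = (c0 + \sum_i c i * a i k * P i)
                          + (\sum_i c i * b i k * P i) * t).
    over.
  rewrite -addrA; congr (_ + _).
  rewrite mulr_suml -big_split; apply: eq_bigr => i _; rewrite /P /=; ring.
rewrite integral_affine; congr EFin.
rewrite -addrA; congr (_ + _).
rewrite mulr_suml -big_split; apply: eq_bigr => i _.
rewrite big_nat_recr //= -/(P i); ring.
Qed.

(** * Upper bound on the adjustable value *)

Lemma ltn_row_major (n m : nat) (i : 'I_n) (j : 'I_m) : (i * m + j < n * m)%N.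
Proof.
apply: (@leq_trans (i.+1 * m)); last by rewrite leq_mul2r ltn_ord orbT.
by rewrite mulSn addnC ltn_add2r.
Qed.

Lemma dotcv_eone (R : realType) (m : nat) (y : 'cV[R]_m) :
  dotcv (eone R m) y = \sum_i y i 0.
Proof. by rewrite /dotcv mxE; apply: eq_bigr => i _; rewrite !mxE mul1r. Qed.

Lemma dotcv0 (R : realType) (m : nat) (y : 'cV[R]_m) : dotcv 0 y = 0.
Proof. by rewrite /dotcv trmx0 mul0mx mxE. Qed.

Lemma mem_conv_pts (R : realType) (k : nat) (pts : seq 'cV[R]_k) p :
  p \in pts -> conv_pts pts p.
Proof.
move=> /(nthP 0)[i isz <-]; pose i0 := Ordinal isz.
exists (fun j => (j == i0)%:R); split=> [j|]; first exact: ler0n.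
split; first by rewrite (bigD1 i0) //= eqxx big1 ?addr0 // => j /negbTE->.
rewrite (bigD1 i0) //= eqxx scale1r big1 ?addr0 // => j /negbTE->.
by rewrite scale0r.
Qed.

(** The weights that express [h] through [pts] also average the recourses. Their sum being 1, the
    average of [A *m x] is itself and the cost bound [K] survives. *)
Lemma second_stage_conv_le (R : realType) (m n : nat) (A B : 'M[R]_(m, n))
    (d x : 'cV[R]_n) (K : R) (pts : seq 'cV[R]_m) (h : 'cV[R]_m) :
  (forall p, p \in pts -> exists y : 'cV[R]_n,
     [/\ cvnonneg y, cvle p (A *m x + B *m y) & dotcv d y <= K]) ->
  conv_pts pts h -> (second_stage A B d x h <= K%:E)%E.
Proof.
move=> pts_ok [w [w0 [w1 ->]]].
have /choice[y y_ok] : forall j : 'I_(size pts), exists y : 'cV[R]_n,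
    [/\ cvnonneg y, cvle pts`_j (A *m x + B *m y) & dotcv d y <= K].
  by move=> j; apply: pts_ok; apply: mem_nth.
apply: (@le_trans _ _ (dotcv d (\sum_j w j *: y j))%:E).
  apply: ereal_inf_lbound => /=; exists (\sum_j w j *: y j) => //; split=> i.
    rewrite summxE mxE; apply: sumr_ge0 => j _; rewrite mxE mulr_ge0 //.
    by have [/(_ i)] := y_ok j; rewrite mxE.
  have -> : A *m x + B *m (\sum_j w j *: y j)
          = \sum_j w j *: (A *m x + B *m y j).
    under [RHS]eq_bigr do rewrite scalerDr.
    rewrite big_split /= -scaler_suml w1 scale1r mulmx_sumr; congr (_ + _).
    by apply: eq_bigr => j _; rewrite scalemxAr.
  rewrite !summxE; apply: ler_sum => j _; rewrite mxE [leRHS]mxE.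
  by apply: ler_wpM2l => //; have [_ /(_ i)] := y_ok j.
rewrite lee_fin -[K]mul1r -w1 mulr_suml /dotcv mulmx_sumr summxE.
apply: ler_sum => j _; rewrite -scalemxAr mxE ler_wpM2l //.
by have [] := y_ok j.
Qed.

Lemma U_ex_0 (R : realType) (m : nat) : U_ex (0 : 'cV[R]_m).
Proof. by apply: mem_conv_pts; rewrite inE eqxx. Qed.

Lemma U_ex_ebase (R : realType) (m : nat) (i : 'I_m) : U_ex (ebase R i).
Proof.
by apply: mem_conv_pts; rewrite inE mem_cat map_f ?mem_enum ?orbT.
Qed.

Lemma U_ex_nu (R : realType) (m : nat) (i : 'I_m) : U_ex (nu R i).
Proof.
by apply: mem_conv_pts; rewrite inE mem_cat orbC (map_f _ (mem_enum _ _)) ?orbT.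
Qed.

Lemma z_AR_Btilde_le (R : realType) (m : nat) (u : nat -> R) (a : R) :
  0 < a -> a <= 1 -> (forall i, (i < m * m)%N -> 0 <= u i <= 1) ->
  (forall i : 'I_m, a * m%:R <= \sum_(j < m) u (i * m + j)%N) ->
  (z_AR 0 (Btilde m u) 0 (eone R m) (@U_ex R m) <= a^-1%:E)%E.
Proof.
move=> a0 a1 u01 row.
have u01' (i j : 'I_m) : 0 <= u (i * m + j)%N <= 1 by exact/u01/ltn_row_major.
have ai1 : 1 <= a^-1 by rewrite invf_ge1.
have B0 (i j : 'I_m) : 0 <= Btilde m u i j.
  rewrite mxE; case: eqP => // _; rewrite mulr_ge0 ?invr_ge0 ?sqrtr_ge0 //.
  by have /andP[] := u01' i j.
apply: (@le_trans _ _ ((dotcv 0 (0 : 'cV[R]_m))%:E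
    + ereal_sup [set second_stage 0 (Btilde m u) (eone R m) 0 h | h in @U_ex R m])%E).
  by apply: ereal_inf_lbound; exists 0 => // i.
rewrite dotcv0 add0e; apply: ge_ereal_sup => _ [h + <-].
apply: second_stage_conv_le => p; rewrite mul0mx.
under eq_exists do rewrite add0r dotcv_eone.
rewrite inE mem_cat => /or3P[/eqP->|/mapP[i _ ->]|/mapP[i _ ->]].
- exists 0; rewrite mulmx0; split=> [//|//|]; rewrite big1 ?invr_ge0 ?ltW // => i _.
  by rewrite mxE.
- exists (ebase R i); split=> [j|j|].
  + by rewrite !mxE eqxx andbT ler0n.
  + rewrite -colE !mxE eqxx andbT; case: (eqVneq j i) => [_|ji] //=.
    by have := B0 j i; rewrite mxE (negbTE ji).
  + rewrite (bigD1 i) //= big1 => [|j /negbTE ji]; rewrite !mxE !eqxx ?ji ?addr0 //.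
- have m0 : 0 < m%:R :> R by rewrite ltr0n; case: (m) i => // - [].
  have s0 : 0 < Num.sqrt (m%:R : R) by rewrite sqrtr_gt0.
  have s1 : 1 <= Num.sqrt (m%:R : R).
    by rewrite -{1}[1]sqrtr1 ler_wsqrtr // ler1n -(ltr0n R).
  (* Chosen so that [const_mx t] costs exactly [a^-1], while a row sum of at least [a * m%:R] times
     [t] is at least 1. *)
  pose t : R := (a * m%:R)^-1.
  have t0 : 0 < t by rewrite invr_gt0 mulr_gt0.
  exists (const_mx t); split=> [j|j|].
  + by rewrite !mxE ltW.
  + apply: (@le_trans _ _ (Num.sqrt (m%:R : R))^-1).
      by rewrite !mxE ler_piMr ?invr_ge0 ?sqrtr_ge0 // gerBl ler0n.
    rewrite mxE; under eq_bigr do rewrite [const_mx _ _ _]mxE.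
    rewrite -mulr_suml.
    (* The row sum also counts the diagonal coordinate; there u / sqrt m <= 1, which is the diagonal
       entry of [Btilde]. *)
    apply: (@le_trans _ _ ((Num.sqrt (m%:R : R))^-1
      * (\sum_(k < m) u (j * m + k)%N) * t)); last first.
      rewrite ler_wpM2r ?(ltW t0) // mulr_sumr; apply: ler_sum => k _.
      rewrite mxE; case: eqP => // _; have /andP[uk0 uk1] := u01' j k.
      by rewrite mulr_ile1 ?invr_ge0 ?(ltW s0) // invf_le1.
    rewrite -mulrA ler_peMr ?invr_ge0 ?(ltW s0) // /t.
    rewrite ler_pdivlMr ?mulr_gt0 //.
    by rewrite mul1r.
  + under eq_bigr do rewrite mxE.
    rewrite sumr_const card_ord -mulr_natr /t invfM -mulrA mulVf ?mulr1 //.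
    by rewrite gt_eqF.
Qed.

(** * Lower bound on the affine value *)

Lemma affine_cost_ge (R : realType) (m : nat) (B : 'M[R]_m) (P : 'M[R]_m)
    (q : 'cV[R]_m) (s := Num.sqrt (m%:R : R)) :
  (4 <= m)%N -> (forall i, B i i = 1) -> (forall i j, i != j -> B i j <= s^-1) ->
  (forall h, U_ex h -> cvle h (B *m (P *m h + q)) /\ cvnonneg (P *m h + q)) ->
  exists2 h, U_ex h & s / 8 <= \sum_j (P *m h + q) j 0.
Proof.
move=> m4 Bii Bij feas.
have s2 : s ^+ 2 = m%:R by rewrite sqr_sqrtr ?ler0n.
have s_ge2 : 2 <= s.
  rewrite -(ler_pXn2r (n := 2)) ?nnegrE ?sqrtr_ge0 // s2 -natrX ler_nat //.
have s0 : 0 < s by lra.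
apply: contrapT => /forall2NP small.
have {small} cost h : U_ex h -> \sum_j (P *m h + q) j 0 < s / 8.
  by move=> Uh; case: (small h) => // /negP; rewrite -ltNge.
pose p j := \sum_k P j k.
have ye i j : (P *m ebase R i + q) j 0 = P j i + q j 0 by rewrite mxE -colE mxE.
have ynu i j : (P *m nu R i + q) j 0 = s^-1 * (p j - P j i) + q j 0.
  rewrite mxE -scalemxAr mxE mulmxBr -colE !mxE; congr (_ * (_ - _) + _).
  by apply: eq_bigr => k _; rewrite mxE mulr1.
(* The policy at h = 0 is [q], so [q] is non-negative and its total [Q] is a cost. *)
have q0 j : 0 <= q j 0.
  by have [_ /(_ j)] := feas _ (U_ex_0 R m); rewrite mulmx0 add0r mxE.
pose Q := \sum_j q j 0; pose T := \sum_j p j; pose tr := \sum_j P j j.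
have Q0 : 0 <= Q by apply: sumr_ge0.
have Qs : Q <= s / 8.
  apply: ltW; have := cost _ (U_ex_0 R m).
  by under eq_bigr do rewrite mulmx0 add0r.
have diag i : 7 / 8 <= P i i + q i 0.
  have [/(_ i)] := feas _ (U_ex_ebase R m i).
  rewrite [leLHS]mxE !eqxx /= mxE => cov y0.
  have yge j : 0 <= (P *m ebase R i + q) j 0 by have := y0 j; rewrite mxE.
  (* Off the diagonal, row i of [B] is at most 1/s and the total cost is below s/8: these terms
     cover at most 1/8 of the demand 1. *)
  have : \sum_j B i j * (P *m ebase R i + q) j 0
       <= (P i i + q i 0) + s^-1 * \sum_j (P *m ebase R i + q) j 0.
    rewrite mulr_sumr (bigD1 i) //= Bii mul1r ye; apply: lerD => //.
    rewrite [leRHS](bigD1 i) //= -[leLHS]add0r lerD ?mulr_ge0 ?invr_ge0 ?(ltW s0) //.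
    by apply: ler_sum => j ji; rewrite ler_wpM2r ?yge // Bij // eq_sym.
  have : s^-1 * \sum_j (P *m ebase R i + q) j 0 <= 1 / 8.
    by rewrite ler_pdivrMl // mulrC mul1r mulrC ltW // cost //; apply: U_ex_ebase.
  move: (\sum_j _) (\sum_j _) cov => X Y cov H1 H2; lra.
have off j : 0 <= s * q j 0 + (p j - P j j).
  have [_ /(_ j)] := feas _ (U_ex_nu R m j).
  rewrite mxE ynu => H; rewrite -(pmulr_rge0 _ (x := s^-1)) ?invr_gt0 //.
  by rewrite mulrDr mulKf ?gt_eqF // addrC.
have sum_diag : 7 / 8 * s ^+ 2 <= tr + Q.
  rewrite s2 /tr /Q -big_split /= -[m in leLHS]card_ord mulr_natr -sumr_const.
  by apply: ler_sum.
have sum_off : 0 <= s * Q + (T - tr).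
  rewrite /Q /T /tr mulr_sumr -sumrB -big_split /=; exact: sumr_ge0.
(* In the sum over i, the entry [P j k] is counted for every i except k, which gives (m - 1) T with
   m = s^2. *)
have sum_nu : s ^+ 2 * Q + s^-1 * ((s ^+ 2 - 1) * T) <= s ^+ 2 * (s / 8).
  have : \sum_(i < m) \sum_j (P *m nu R i + q) j 0 <= \sum_(i < m) (s / 8).
    by apply: ler_sum => i _; rewrite ltW // cost //; apply: U_ex_nu.
  rewrite sumr_const card_ord -[_ *+ m]mulr_natl -s2; apply: le_trans.
  under eq_bigr do under eq_bigr do rewrite ynu.
  under eq_bigr do rewrite big_split /= -mulr_sumr.
  rewrite big_split /= sumr_const card_ord -[Q *+ m]mulr_natl -s2.
  rewrite [leLHS]addrC lerD2r -mulr_sumr ler_pM2l ?invr_gt0 //.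
  under [leRHS]eq_bigr do rewrite sumrB -/T.
  rewrite sumrB sumr_const card_ord exchange_big /= -/T -[_ *+ m]mulr_natl -s2.
  by rewrite mulrBl mul1r.
have {}sum_nu : s ^+ 3 * Q + (s ^+ 2 - 1) * T <= s ^+ 4 / 8.
  have := ler_wpM2l (ltW s0) sum_nu.
  by rewrite mulrDr mulVKf ?gt_eqF //; lra.
have T_ge : 7 / 8 * s ^+ 2 - (1 + s) * Q <= T by lra.
have := ler_wpM2l (_ : 0 <= s ^+ 2 - 1) T_ge.
have s21 : 0 <= s ^+ 2 - 1 by nra.
move=> /(_ s21) H.
(* Once [T_ge] is inserted in [sum_nu], the coefficient of [Q] is s^3 - (s^2 - 1)(1 + s) = -(s^2 - s
   - 1), negative for s >= 2, so the upper bound [Qs] is the one to use. *)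
have H2 : (s ^+ 2 - s - 1) * Q <= (s ^+ 2 - s - 1) * (s / 8).
  by apply: ler_wpM2l => //; nra.
have : s ^+ 2 * (6 * s ^+ 2 - s - 7) <= 0 by nra.
by rewrite pmulr_rle0 ?exprn_gt0 //; nra.
Qed.

Lemma z_Aff_Btilde_ge (R : realType) (m : nat) (u : nat -> R) :
  (4 <= m)%N -> (forall i, (i < m * m)%N -> 0 <= u i <= 1) ->
  ((Num.sqrt (m%:R : R) / 8)%:E
     <= z_Aff 0 (Btilde m u) 0 (eone R m) (@U_ex R m))%E.
Proof.
move=> m4 u01; apply: le_ereal_inf_tmp => _ [[[x P] q] /= [_ feas] <-].
rewrite dotcv0 add0e.
have [|i j ij|h Uh|h Uh le_cost] := @affine_cost_ge R m (Btilde m u) P q m4.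
- by move=> i; rewrite mxE eqxx.
- rewrite mxE (negbTE ij) ler_piMr ?invr_ge0 ?sqrtr_ge0 //.
  by have /u01/andP[] := ltn_row_major m m i j.
- by have := feas h Uh; rewrite mul0mx add0r.
- apply: (@le_trans _ _ (\sum_j (P *m h + q) j 0)%:E).
    by rewrite lee_fin.
  by apply: ereal_sup_ubound; exists h; rewrite ?dotcv_eone.
Qed.

(** * Chernoff bound and probability estimate *)

Lemma expRN_le_affine (R : realType) (t : R) :
  0 <= t <= 1 -> expR (- t) <= 1 - t / 2.
Proof.
move=> /andP[t0 t1]; rewrite expRN.
apply: (@le_trans _ _ (1 + t)^-1).
  by rewrite lef_pV2 ?posrE ?expR_gt0 ?expR_ge1Dx //; lra.
(* (1 + t)(1 - t/2) = 1 + t(1 - t)/2 >= 1 on [0, 1]. *)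
rewrite -div1r ler_pdivrMr; [nra|lra].
Qed.

(** Pointwise exponential Markov inequality: exp (a - sum v) >= 1. Replacing each exp (- v_j) by an
    affine majorant yields a product that [cube_int_sum_prod_affine] integrates exactly. *)
Lemma row_chernoff (R : realType) (m : nat) (a : R) (v : 'I_m -> R) :
  (forall j, 0 <= v j <= 1) -> \sum_j v j <= a ->
  1 <= expR a * \prod_j (1 - v j / 2).
Proof.
move=> v01 va; rewrite mulrC -ler_pdivrMr ?expR_gt0 // div1r -expRN.
apply: (@le_trans _ _ (expR (- \sum_j v j))); first by rewrite ler_expR lerN2.
rewrite -sumrN expR_sum; apply: ler_prod => j _.
by rewrite expR_ge0 expRN_le_affine.
Qed.

(** Coordinates are numbered row by row, so [l %/ m] is the row of [l]; this converts a product over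
    all coordinates of the cube into one over row [i]. *)
Lemma prod_block (R : comNzRingType) (n m : nat) (F : nat -> R) (i : 'I_n) :
  (0 < m)%N ->
  \prod_(0 <= l < n * m) (if (l %/ m)%N == i then F l else 1)
  = \prod_(j < m) F (i * m + j)%N.
Proof.
move=> m0; rewrite big_nat_mul big_mkord (bigD1 i) //= [X in _ * X]big1; last first.
  move=> k ki; apply: big1_seq => l; rewrite mem_index_iota => /andP[_ /andP[kl lk]].
  have -> : (l %/ m)%N = k.
    by apply/eqP; rewrite eqn_leq leq_divRL // kl andbT -ltnS ltn_divLR.
  by rewrite -[_ == _]/(val k == val i) val_eqE (negbTE ki).
rewrite mulr1 -{1}[(i * m)%N]add0n big_addn mulSn addnK big_mkord.
by apply: eq_bigr => j _; rewrite addnC divnMDl // divn_small // addn0 eqxx.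
Qed.

(** The cubic term of exp (m/8) is m^3 / 3072, at least m^2 for m >= 3072. *)
Lemma sq_mul_expRN_le1 (R : realType) (m : nat) :
  (2 ^ 12 <= m)%N -> m%:R ^+ 2 * expR (- (m%:R / 8 : R)) <= 1.
Proof.
rewrite -(ler_nat R) natrX => m_ge.
rewrite expRN ler_pdivrMr ?expR_gt0 // mul1r.
have x0 : 0 <= m%:R / 8 :> R by rewrite divr_ge0.
apply: le_trans (expR_ge1Dxn 2 x0).
move: (m%:R : R) m_ge {x0} => x; rewrite (_ : 3`! = 6%N) // => x_ge.
have x2 := sqr_ge0 x; have := ler_wpM2r x2 x_ge; lra.
Qed.

Theorem theorem3 (R : realType) :
  exists C : R, 0 < C /\
  exists m0 : nat, forall m : nat, (0 < m)%N -> (m0 <= m)%N ->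
    ((1 - (m%:R : R)^-1)%:E <=
     cube_prob (m * m)
       [set u : nat -> R |
          ((C * Num.sqrt (m%:R : R))%:E
             * z_AR 0 (Btilde m u) 0 (eone R m) (@U_ex R m)
           <= z_Aff 0 (Btilde m u) 0 (eone R m) (@U_ex R m))%E])%E.
Proof.
(* 1/64 = (1/8) / 8: the affine value is at least sqrt m / 8, the adjustable one at most 8. *)
exists (1 / 64); split; first by lra.
exists (2 ^ 12)%N => m m_gt0 m_ge; rewrite /cube_prob.
pose b (i : 'I_m) l : R := if (l %/ m)%N == i then - (1 / 2) else 0.
pose c : R := expR (m%:R / 8).
have prodE (v : nat -> R) (i : 'I_m) :
    \prod_(0 <= l < m * m) (1 + b i l * v l)
    = \prod_(j < m) (1 - v (i * m + j)%N / 2).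
  rewrite -(prod_block _ _ _ (fun l => 1 - v l / 2)) //; apply: eq_big_nat => l _.
  by rewrite /b; case: ifP => _; [field|rewrite mul0r addr0].
apply: (@le_trans _ _ (cube_int (m * m) (fun u : nat -> R =>
  (1 + \sum_i (- c) * \prod_(0 <= l < m * m) (1 + b i l * u l))%:E))).
  rewrite (cube_int_sum_prod_affine _ _ _ _ _ (fun _ _ => 1)) lee_fin lerD2l.
  (* Each of the m factors of a row has mean 1 - 1/4 = 3/4. *)
  under eq_bigr do rewrite (prodE (fun=> 2^-1)) prodr_const card_ord.
  rewrite sumr_const card_ord mulNr mulNrn lerN2 -[_ *+ m]mulr_natl.
  have m0 : 0 < m%:R :> R by rewrite ltr0n.
  rewrite -[leRHS]mul1r ler_pdivlMr // mulrC [leLHS]mulrA -expr2.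
  apply: le_trans (sq_mul_expRN_le1 _ _ m_ge); rewrite ler_wpM2l ?sqr_ge0 //.
  rewrite -ler_pdivlMl ?expR_gt0 // -expRN -expRD.
  rewrite [X in expR X](_ : _ = - (1 / 4) * m%:R); last by field.
  (* exp (1/8) * 3/4 <= exp (-1/8), because 3/4 = 1 - 1/4 <= exp (-1/4) *)
  rewrite expRM_natr lerXn2r ?nnegrE ?expR_ge0 //; first by lra.
  by apply: le_trans (expR_ge1Dx _); lra.
apply: cube_int_mono => u u01; rewrite lee_fin indicE.
have u01' (i j : 'I_m) : 0 <= u (i * m + j)%N <= 1 by exact/u01/ltn_row_major.
have c0 : 0 <= c by exact: expR_ge0.
under eq_bigr do rewrite prodE mulNr.
rewrite sumrN.
have P0 (i : 'I_m) : 0 <= c * \prod_(j < m) (1 - u (i * m + j)%N / 2).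
  by rewrite mulr_ge0 // prodr_ge0 // => j _; have := u01' i j; lra.
(* If all rows are good, the event holds and the minorant is at most 1; otherwise the term of one
   bad row is already at least 1 and the minorant is at most 0. *)
have [good|/existsNP[i bad]] := pselect (forall i : 'I_m,
    1 / 8 * m%:R <= \sum_(j < m) u (i * m + j)%N).
  rewrite mem_set.
    by rewrite gerBl; apply: sumr_ge0.
  have m4 : (4 <= m)%N by apply: leq_trans m_ge.
  rewrite /=; apply: le_trans (z_Aff_Btilde_ge _ _ _ m4 u01).
  apply: (@le_trans _ _ ((1 / 64 * Num.sqrt m%:R)%:E * ((1 / 8)^-1)%:E)%E).
    apply: lee_wpmul2l; first by rewrite lee_fin mulr_ge0 ?sqrtr_ge0.
    by apply: z_AR_Btilde_le => //; lra.
  by rewrite -EFinM lee_fin; lra.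
apply: (@le_trans _ _ 0); last by rewrite ler0n.
rewrite subr_le0 (bigD1 i) //= ler_wpDr ?sumr_ge0 //.
apply: row_chernoff => //.
by move/negP: bad; rewrite -ltNge => /ltW; rewrite mulrC mul1r.
Qed.
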